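(* Let $\mathbb{K}$ be a field, let $G$ be a bipartite graph with at least one edge and vertex set $\{v_1,\dots,v_n\}$, let $S=\mathbb{K}[x_1,\dots,x_n]$, and let $I(G)\subseteq S$ be the edge ideal of $G$. Suppose that $p$ is the number of connected components of $G$ and assume that $g$ is the maximum girth of connected components of $G$. Then for every positive integer $k\leq g/2+1$, we have ${\rm sdepth}(I(G)^k)\geq p+1$.
   Context: Graphs are finite and simple. The edge ideal of $G$ is $I(G)=(x_ix_j : \{v_i,v_j\}\in E(G))\subseteq S$. The girth of a graph is the length of a shortest cycle, and it is set to be $\infty$ if the graph has no cycle (if $g=\infty$, the condition $k\leq g/2+1$ holds for every positive integer $k$). Stanley depth: let $M$ be a finitely generated $\mathbb{Z}^n$-graded $S$-module. For a homogeneous $u\in M$ and $Z\subseteq\{x_1,\dots,x_n\}$, the $\mathbb{K}$-subspace $u\mathbb{K}[Z]$ of $M$ generated by all $uv$ with $v$ a monomial in $\mathbb{K}[Z]$ is called a Stanley space of dimension $|Z|$ if it is a free $\mathbb{K}[Z]$-module. A Stanley decomposition $\mathcal{D}$ of $M$ is a decomposition of $M$ (as a $\mathbb{K}$-vector space) as a finite direct sum of Stanley spaces; ${\rm sdepth}(\mathcal{D})$ is the minimum dimension of a Stanley space in $\mathcal{D}$, and ${\rm sdepth}(M)$ is the maximum of ${\rm sdepth}(\mathcal{D})$ over all Stanley decompositions $\mathcal{D}$ of $M$. By convention ${\rm sdepth}(0)=\infty$. *)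

(* Defs.v *)
From HB Require Import structures.
From mathcomp Require Import all_boot all_order all_algebra.
From mathcomp Require Import mpoly.
From mathcomp Require Import boolp.

Set Implicit Arguments.
Unset Strict Implicit.
Unset Printing Implicit Defensive.

Import Order.TTheory GRing.Theory Num.Theory.
Local Open Scope ring_scope.

(* Natural numbers extended by infinity: the values of girth and of sdepth. *)
Inductive enat : Type := Fin of nat | Infty.

Definition lee (a b : enat) : bool :=
  match a, b with
  | _, Infty => true
  | Infty, Fin _ => false
  | Fin m, Fin n => (m <= n)%N
  end.

Definition mine (a b : enat) : enat := if lee a b then a else b.
Definition maxe (a b : enat) : enat := if lee a b then b else a.

(* k <= g / 2 + 1, the division being that of rational numbers; the condition
   holds for every k when g is infinite. *)
Definition le_half_plus1 (k : nat) (g : enat) : bool :=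
  if g is Fin m then k%:R <= (m%:R / 2%:R + 1 : rat) else true.

Section Graphs.

Variables (T : finType) (e : rel T).

Definition simple_graph : Prop := ssrbool.symmetric e /\ irreflexive e.

Definition bipartite : Prop :=
  exists A : {set T}, forall x y, e x y -> (x \in A) != (y \in A).

(* A cycle of the subgraph induced on A is a cyclic sequence of m >= 3 distinct
   vertices of A, any two consecutive ones being adjacent. *)
Definition has_cycle_of_length (A : {pred T}) (m : nat) : bool :=
  (2 < m)%N && [exists c : m.-tuple T, ucycleb e c && (c \subset A)].

(* A cycle has at most #|T| vertices; the empty minimum is Infty. *)
Definition girth (A : {pred T}) : enat :=
  \big[mine/Infty]_(m < #|T|.+1 | has_cycle_of_length A m) Fin m.

Definition num_components : nat := n_comp e T.

(* [roots e] contains exactly one vertex of each connected component, and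
   [connect e v] is the vertex set of the component of v. *)
Definition max_component_girth : enat :=
  \big[maxe/Fin 0]_(v | v \in roots e) girth (connect e v).

End Graphs.

Section Ideals.

Variable R : comNzRingType.

Definition ideal_gen (A : R -> Prop) (f : R) : Prop :=
  exists s : seq (R * R),
    (forall t, t \in s -> A t.2) /\ f = \sum_(t <- s) t.1 * t.2.

Definition ideal_mul (I J : R -> Prop) : R -> Prop :=
  ideal_gen (fun f => exists a b, [/\ I a, J b & f = a * b]).

Definition ideal_exp (I : R -> Prop) (k : nat) : R -> Prop :=
  iter k (ideal_mul I) (fun _ => True).

End Ideals.

Definition edge_ideal (K : fieldType) (n : nat) (e : rel 'I_n) :
    {mpoly K[n]} -> Prop :=
  ideal_gen (fun f => exists i j, e i j /\ f = 'X_i * 'X_j).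

Arguments edge_ideal K [n] e.

(* Stanley depth of a Z^n-graded submodule M of S = K[x_1, ..., x_n]. *)
Section StanleyDepth.

Variables (K : fieldType) (n : nat).
Local Notation S := {mpoly K[n]}.

Definition homogeneous (u : S) : Prop :=
  exists (c : K) (m : 'X_{1..n}), u = c *: 'X_[m].

(* The subring K[Z] of S. *)
Definition poly_in (Z : {set 'I_n}) (f : S) : Prop :=
  forall m : 'X_{1..n}, m \in msupp f -> forall i, m i != 0%N -> i \in Z.

(* The K-span u K[Z] of the products of u with the monomials of K[Z]. *)
Definition stanley_span (u : S) (Z : {set 'I_n}) (w : S) : Prop :=
  exists2 f, poly_in Z f & w = u * f.

(* Freeness of u K[Z] over K[Z], with basis u. *)
Definition stanley_free (u : S) (Z : {set 'I_n}) : Prop :=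
  forall f, poly_in Z f -> u * f = 0 -> f = 0.

Record stanley_decomposition (M : S -> Prop) : Type := StanleyDecomposition {
  sd_size : nat;
  sd_gen : 'I_sd_size -> S;
  sd_vars : 'I_sd_size -> {set 'I_n};
  sd_homogeneous : forall i, homogeneous (sd_gen i);
  sd_free : forall i, stanley_free (sd_gen i) (sd_vars i);
  sd_sum : forall w, M w <->
    exists2 s : 'I_sd_size -> S,
      forall i, stanley_span (sd_gen i) (sd_vars i) (s i) & w = \sum_i s i;
  sd_direct : forall s : 'I_sd_size -> S,
    (forall i, stanley_span (sd_gen i) (sd_vars i) (s i)) ->
    \sum_i s i = 0 -> forall i, s i = 0
}.

Arguments sd_gen [M] D i : rename.
Arguments sd_vars [M] D i : rename.

(* Stanley spaces have dimension at most n, so the default value n does not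
   affect the minimum of a nonempty family. *)
Definition sdepth_decomposition (M : S -> Prop)
    (D : stanley_decomposition M) : nat :=
  \big[minn/n]_(i < sd_size D) #|sd_vars D i|.

Definition sdepth (M : S -> Prop) : enat :=
  if `[< forall f, M f -> f = 0 >] then Infty
  else Fin (\max_(d < n.+1 |
    `[< exists D : stanley_decomposition M, sdepth_decomposition D = d >]) d).

End StanleyDepth.

(* Main.v *)
Require Import Defs.
From mathcomp Require Import all_boot all_order all_algebra.
From mathcomp Require Import mpoly.
From mathcomp Require Import boolp zify.

(** A Stanley decomposition of a monomial ideal amounts to a partition of its
    monomials into finitely many translated orthants [c + N^Z], and the bound
    asks for orthants with [num_components e + 1] free directions.

    Since the graph is bipartite, Koenig duality describes the monomials: [x^u]
    lies in the [k]-th power of the edge ideal exactly when every vertex cover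
    has [u]-weight at least [k] ([ideal_exp_edge_idealP], whose core is
    [covers_weigh_remove_edge]). This condition does not change when [u] is
    truncated at [k], so only the finite box of points with coordinates at most
    [k] has to be partitioned ([sdepth_ge_of_free_directions]).

    Fix an endpoint [x0] of some edge. Removing [x0] leaves one nonempty block
    of vertices for each connected component; let the weight of a block be the
    least weight of a cover of it, truncated at [k]. In a bipartite graph, the
    lightest cover of a block may be assumed to omit some vertex of the block,
    and raising [u] at that vertex does not change the weight of the block.
    Take the least such vertex in each block as a free direction, together with
    [x0]: these are [num_components e + 1] directions ([card_free_dirs]).

    Moving upward along the free directions keeps the block weights, so that it
    can only shrink the set of eligible vertices, and the chosen ones stay
    eligible: the directions do not change ([free_dirs_raise]). Two points with
    the same directions that agree elsewhere have the same block weights and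
    differ in at most one coordinate of each block. Their membership in the
    power of the ideal reads: the coordinate at [x0] plus the sum of the block
    weights is at least [k], for covers that contain [x0], and a condition that
    involves only the block next to [x0] besides block weights, for covers that
    omit [x0]. The coordinatewise minimum inherits both conditions
    ([covers_weigh_meet]). Hence the points with given directions and given
    other coordinates have a least element, and they form an orthant. *)

Set Implicit Arguments.
Unset Strict Implicit.
Unset Printing Implicit Defensive.

Local Open Scope nat_scope.

(** * Vertex covers of weighted bipartite graphs *)

Section Covers.

Variables (T : finType) (e : rel T).
Implicit Types (u v m : T -> nat) (A C D : {set T}).

Definition vertex_cover C :=
  [forall x, forall y, e x y ==> (x \in C) || (y \in C)].

Definition weight u C := \sum_(i in C) u i.

Definition covers_weigh k u := [forall C, vertex_cover C ==> (k <= weight u C)].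

Lemma vertex_coverP C :
  reflect (forall x y, e x y -> (x \in C) || (y \in C)) (vertex_cover C).
Proof.
apply: (iffP 'forall_forallP) => cov x y; first exact/implyP.
by apply/implyP; apply: cov.
Qed.

Lemma covers_weighP k u :
  reflect (forall C, vertex_cover C -> k <= weight u C) (covers_weigh k u).
Proof.
apply: (iffP forallP) => cov C; first exact/implyP.
by apply/implyP; apply: cov.
Qed.

Lemma weightE u C : weight u C = \sum_i (i \in C) * u i.
Proof.
by rewrite /weight big_mkcond; apply: eq_bigr => i _; case: (i \in C); rewrite ?mul1n.
Qed.

Lemma leq_weight u v C : (forall i, i \in C -> u i <= v i) -> weight u C <= weight v C.
Proof. exact: leq_sum. Qed.

Lemma covers_weigh_leq k u v :
  (forall i, u i <= v i) -> covers_weigh k u -> covers_weigh k v.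
Proof.
move=> le_uv /covers_weighP uP; apply/covers_weighP => C /uP/leq_trans; apply.
by apply: leq_weight.
Qed.

(** A cover containing a vertex where the truncation is active has weight at
    least [k] already there; the weights of the other covers are unchanged. *)
Lemma covers_weigh_trunc k u :
  covers_weigh k (fun i => minn (u i) k) = covers_weigh k u.
Proof.
apply/idP/idP; first by apply: covers_weigh_leq => i; rewrite geq_minl.
move=> /covers_weighP uP; apply/covers_weighP => C /uP le_k.
have [/existsP[i /andP[iC le_ki]]|/existsPn small] := boolP [exists i, (i \in C) && (k <= u i)].
  rewrite /weight (bigD1 i) //= (minn_idPr le_ki); exact: leq_addr.
rewrite (leq_trans le_k) // leq_weight // => i iC.
by have := small i; rewrite iC /= -ltnNge => /ltnW/minn_idPl->.
Qed.

(** Covers of a bipartite graph form a distributive lattice on which weights are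
    modular; in particular the lightest covers form a sublattice. *)
Lemma vertex_cover_uncross A D1 D2 :
    (forall x y, e x y -> (x \in A) != (y \in A)) ->
    vertex_cover D1 -> vertex_cover D2 ->
  let J := [set i | if i \in A then (i \in D1) && (i \in D2)
                    else (i \in D1) || (i \in D2)] in
  let M := [set i | if i \in A then (i \in D1) || (i \in D2)
                    else (i \in D1) && (i \in D2)] in
  [/\ vertex_cover J, vertex_cover M
    & forall u, weight u J + weight u M = weight u D1 + weight u D2].
Proof.
move=> bip /vertex_coverP cov1 /vertex_coverP cov2 J M; split.
- apply/vertex_coverP => x y exy; rewrite !inE.
  move: (bip _ _ exy) (cov1 _ _ exy) (cov2 _ _ exy).
  by do !case: (_ \in _).
- apply/vertex_coverP => x y exy; rewrite !inE.
  move: (bip _ _ exy) (cov1 _ _ exy) (cov2 _ _ exy).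
  by do !case: (_ \in _).
move=> u; rewrite !weightE -!big_split; apply: eq_bigr => i _ /=.
by rewrite !inE; do !case: (_ \in _); rewrite ?addn0 ?add0n.
Qed.

(** The induction step of Koenig duality. Take a vertex [x] with a neighbour in
    the support of [m]. If removing the edge from [x] to [y] is wrong for each
    such neighbour [y], then a lightest cover contains both [x] and [y]. The
    join of these covers is a lightest cover [D] that contains [x] and all its
    neighbours in the support; replacing [x] in [D] by vertices of weight zero
    gives a lighter cover. *)
Lemma covers_weigh_remove_edge k m :
    ssrbool.symmetric e -> bipartite e -> covers_weigh k.+1 m ->
  exists x y, [/\ e x y, 0 < m x, 0 < m y
    & covers_weigh k (fun i => m i - (i == x) - (i == y))].
Proof.
move=> sym_e [A0 bip0] /covers_weighP mP.
have [x [y0 [exy0 mx my0]]] : exists x y, [/\ e x y, 0 < m x & 0 < m y].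
  apply: contrapT => noedge.
  (* otherwise the vertices outside the support form a cover of weight 0 *)
  have /mP : vertex_cover [set i | m i == 0].
    apply/vertex_coverP => x y exy; rewrite !inE -[_ || _]negbK negb_or -!lt0n.
    by apply/negP => /andP[mx my]; apply: noedge; exists x, y.
  by rewrite /weight big1 // => i; rewrite inE => /eqP.
suff [y [exy my ok]] : exists y, [/\ e x y, 0 < m y
    & covers_weigh k (fun i => m i - (i == x) - (i == y))] by exists x, y.
apply: contrapT => bad.
have tight y : e x y -> 0 < m y ->
    exists D, [/\ vertex_cover D, weight m D = k.+1, x \in D & y \in D].
  move=> exy my.
  have [ok|/forallPn[D]] := boolP (covers_weigh k (fun i => m i - (i == x) - (i == y))).
    by case: bad; exists y.
  rewrite negb_imply -ltnNge => /andP[covD ltD]; exists D.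
  have drop2 : weight m D <= weight (fun i => m i - (i == x) - (i == y)) D
                       + (x \in D) + (y \in D).
    have ind z : \sum_(i in D) (i == z) = (z \in D).
      case: (boolP (z \in D)) => zD.
        by rewrite (bigD1 z) //= eqxx big1 // => i /andP[_ /negPf->].
      by rewrite big1 // => i iD; case: eqP => // iz; rewrite iz (negPf zD) in iD.
    rewrite -(ind x) -(ind y) /weight -!big_split /=.
    by apply: leq_sum => i _; lia.
  have leD := mP _ covD.
  by split=> //; move: ltD drop2 leD; case: (x \in D); case: (y \in D); lia.
(* the side of [x], on which the join of covers is an intersection *)
pose A := if x \in A0 then A0 else ~: A0.
have bip a b : e a b -> (a \in A) != (b \in A).
  by move/bip0; rewrite /A; case: ifP => _ //; rewrite !inE; do !case: (_ \in _).
have xA : x \in A by rewrite /A; case: ifP => // /negbT; rewrite inE.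
have [D [covD wD xD posD]] : exists D, [/\ vertex_cover D, weight m D = k.+1, x \in D
    & forall y, y \in enum [pred y | e x y && (0 < m y)] -> y \in D].
  have : forall y, y \in enum [pred y | e x y && (0 < m y)] -> e x y && (0 < m y).
    by move=> y; rewrite mem_enum.
  elim: (enum _) => [_|y s IHs pos].
    by have [D [? ? ? _]] := tight y0 exy0 my0; exists D; split.
  have [|D1 [cov1 w1 x1 s1]] := IHs; first by move=> z zs; apply: pos; rewrite inE zs orbT.
  have /andP[exy my] := pos y (mem_head _ _).
  have [D2 [cov2 w2 x2 y2]] := tight y exy my.
  have [covJ covM] := vertex_cover_uncross bip cov1 cov2.
  set J := [set _ | _] in covJ *; set M := [set _ | _] in covM * => wJM.
  exists J; split=> //.
  - by have := wJM m; have := mP _ covJ; have := mP _ covM; lia.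
  - by rewrite inE xA x1.
  move=> z zs; have /andP[exz _] := pos z zs; rewrite inE.
  have := bip _ _ exz; rewrite xA; case: (z \in A) => // _.
  by move: zs; rewrite inE => /predU1P[->|/s1->] //; rewrite y2 orbT.
have /mP : vertex_cover ((D :\ x) :|: [set i | m i == 0]).
  apply/vertex_coverP => a b eab; rewrite !inE.
  have pos z : e x z -> (z != x) && (z \in D) || (m z == 0).
    move=> exz; have [//|] := eqVneq (m z) 0; first by rewrite orbT.
    rewrite -lt0n => mz; rewrite orbF posD ?mem_enum ?inE ?exz // andbT.
    by apply/eqP => zx; move: (bip _ _ exz); rewrite zx eqxx.
  have [ax|_] := eqVneq a x; first by rewrite ax in eab; rewrite (pos b eab) orbT.
  have [bx|_] := eqVneq b x.
    by have := pos a; rewrite -bx sym_e => /(_ eab); case: (a \in D); rewrite ?andbF //= => ->.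
  by have /orP[->|->] := vertex_coverP _ covD _ _ eab; rewrite ?orbT.
rewrite leqNgt => /negP; apply.
have := wD; rewrite /weight (bigD1 x) //= => wDx.
suff : weight m (D :\ x :|: [set i | m i == 0]) <= \sum_(i in D | i != x) m i.
  by rewrite /weight; lia.
rewrite /weight big_mkcond [X in _ <= X]big_mkcond; apply: leq_sum => i _; rewrite !inE.
by have [->|] := eqVneq (m i) 0; do ?case: (_ \in _); do ?case: eqP.
Qed.

End Covers.

(** * Free directions at a point *)

Section FreeDirections.

Variables (n : nat) (e : rel 'I_n) (x0 : 'I_n) (k : nat).
Hypothesis sym_e : ssrbool.symmetric e.
Local Notation comp := (fingraph.root e).
Implicit Types (u v w : 'I_n -> nat) (C D : {set 'I_n}) (i j r : 'I_n).

Definition block r := [set i | (comp i == r) && (i != x0)].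

(** Restricting the covers of the whole graph to a block gives all the covers of
    the block: those that contain [x0] impose nothing on the edges at [x0]. The
    weight is truncated at [k] because raising a coordinate to [k] stands for
    raising it to infinity. *)
Definition block_weight r u :=
  \big[minn/k]_(C : {set 'I_n} | vertex_cover e C) weight u (C :&: block r).

Definition raise u i := fun j => if j == i then k else u j.

Definition raisable u i :=
  (i != x0) && (block_weight (comp i) (raise u i) == block_weight (comp i) u).

(** Taking the least raisable vertex of a block, rather than any of them, makes
    the choice stable when the set of raisable vertices shrinks but keeps the
    chosen one. *)
Definition free_dirs u : {set 'I_n} :=
  [set i | (i == x0)
        || raisable u i && [forall j : 'I_n, (j < i) && (comp j == comp i) ==> ~~ raisable u j]].

Lemma root_edge i j : e i j -> comp i = comp j.
Proof. by move=> eij; apply/(fingraph.rootP (sym_connect_sym sym_e)); apply: connect1. Qed.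

Lemma mem_block i r : (i \in block r) = (comp i == r) && (i != x0).
Proof. by rewrite inE. Qed.

Lemma block_weight_le r u C :
  vertex_cover e C -> block_weight r u <= weight u (C :&: block r).
Proof.
move=> covC; rewrite /block_weight; have := mem_index_enum C.
elim: (index_enum _) => // D s IHs; rewrite inE big_cons.
move=> /predU1P[<-|/IHs le_s]; first by rewrite covC geq_minl.
by case: ifP => // _; apply: leq_trans (geq_minr _ _) le_s.
Qed.

Lemma block_weight_lek r u : block_weight r u <= k.
Proof.
rewrite /block_weight; elim/big_rec: _ => // C t _ le_t.
exact: leq_trans (geq_minr _ _) le_t.
Qed.

Lemma block_weight_attained r u :
  block_weight r u = k \/
  exists2 C, vertex_cover e C & weight u (C :&: block r) = block_weight r u.
Proof.
rewrite /block_weight; elim/big_rec: _ => [|C t covC IH]; first by left.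
by case: leqP => _ //; right; exists C.
Qed.

Lemma block_weight_leq r u v :
  (forall i, i \in block r -> u i <= v i) -> block_weight r u <= block_weight r v.
Proof.
move=> le_uv; have [->|[C covC <-]] := block_weight_attained r v.
  exact: block_weight_lek.
apply: leq_trans (block_weight_le _ _ covC) _.
by apply: leq_weight => i /setIP[_ /le_uv].
Qed.

Lemma eq_block_weight r u v :
  (forall i, i \in block r -> u i = v i) -> block_weight r u = block_weight r v.
Proof.
by move=> uv; apply/eqP; rewrite eqn_leq !block_weight_leq // => i /uv->.
Qed.

Lemma eq_raisable i u v :
  (forall j, j \in block (comp i) -> u j = v j) -> raisable u i = raisable v i.
Proof.
move=> uv; rewrite /raisable (eq_block_weight uv).
congr (_ && (_ == _)); apply: eq_block_weight => j jr.
by rewrite /raise; case: eqP => // _; apply: uv.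
Qed.

Lemma raisable_neq u i : raisable u i -> i != x0.
Proof. by case/andP. Qed.

Lemma mem_free_dirs u i : i != x0 ->
  (i \in free_dirs u) = raisable u i
    && [forall j : 'I_n, (j < i) && (comp j == comp i) ==> ~~ raisable u j].
Proof. by move=> /negPf i0; rewrite inE i0. Qed.

Lemma eq_free_dirs i u v :
  (forall j, j \in block (comp i) -> u j = v j) ->
  (i \in free_dirs u) = (i \in free_dirs v).
Proof.
move=> uv; rewrite !inE (eq_raisable uv); congr (_ || (_ && _)).
apply: eq_forallb => j; case: andP => //= -[_ /eqP ji].
by congr (~~ _); apply: eq_raisable; rewrite ji.
Qed.

Lemma free_dirs_inj u i j : i \in free_dirs u -> j \in free_dirs u ->
  i != x0 -> j != x0 -> comp i = comp j -> i = j.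
Proof.
move=> + + i0 j0 rij; rewrite !mem_free_dirs //.
move=> /andP[gi /forallP mini] /andP[gj /forallP minj].
apply: val_inj; have [lt_ij|lt_ji|//] := ltngtP i j.
  by have := minj i; rewrite lt_ij rij eqxx gi.
by have := mini j; rewrite lt_ji rij eqxx gj.
Qed.

Lemma raisable_free_dir u i :
  raisable u i -> exists2 j, j \in free_dirs u & (j != x0) && (comp j == comp i).
Proof.
move=> gi; pose p j := raisable u j && (comp j == comp i).
have pi : p i by rewrite /p gi eqxx.
case: (arg_minnP (fun j : 'I_n => val j) pi) => j /andP[gj rj] minj.
exists j; last by rewrite rj (raisable_neq gj).
rewrite mem_free_dirs ?(raisable_neq gj) // gj; apply/forallP => l; apply/implyP.
move=> /andP[lt_lj rlj]; apply/negP => gl.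
by have := minj l; rewrite /p gl (eqP rlj) rj => /(_ isT); rewrite leqNgt lt_lj.
Qed.

(** If a cover attaining the weight of the block omits a vertex of the block,
    that vertex can be raised. If it contains the whole block, the two sides of
    the bipartition are covers that are no heavier on the block, and each vertex
    is omitted by one of them. *)
Lemma exists_raisable r u : bipartite e -> (forall i, u i <= k) ->
  (exists i, i \in block r) -> exists2 i, comp i = r & raisable u i.
Proof.
move=> [A bip] le_k [i0 i0r].
have up i : block_weight r u <= block_weight r (raise u i).
  by apply: block_weight_leq => j _; rewrite /raise; case: eqP => // ->.
suff [i ir le_i] : exists2 i, i \in block r & block_weight r (raise u i) <= block_weight r u.
  move: ir; rewrite mem_block => /andP[/eqP ri ix0]; exists i => //.
  by rewrite /raisable ix0 ri eqn_leq le_i up.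
have [->|[C covC wC]] := block_weight_attained r u.
  by exists i0 => //; apply: block_weight_lek.
have outside D i : vertex_cover e D -> i \in block r -> i \notin D ->
    weight u (D :&: block r) <= block_weight r u ->
    exists2 i, i \in block r & block_weight r (raise u i) <= block_weight r u.
  move=> covD ir iD leD; exists i => //.
  apply: leq_trans (block_weight_le _ _ covD) (leq_trans _ leD).
  apply: leq_weight => j /setIP[jD _]; rewrite /raise.
  by case: eqP => // ji; rewrite ji (negPf iD) in jD.
have [sub|/subsetPn[i ir iC]] := boolP (block r \subset C); last first.
  by apply: (outside C i) => //; rewrite wC.
pose D := if i0 \in A then ~: A else A.
apply: (outside D i0) => //.
- apply/vertex_coverP => x y /bip; rewrite /D.
  by case: ifP => _; rewrite ?inE; do !case: (_ \in _).
- by rewrite /D; case: ifP => [|->] //; rewrite inE => ->.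
rewrite -wC (setIidPr sub) !weightE; apply: leq_sum => i _.
by rewrite inE; case: (i \in D).
Qed.

(** The vertex [x0] must have a neighbour for its own block to be nonempty. *)
Lemma card_free_dirs u : bipartite e -> (forall i, u i <= k) ->
  (exists y, e x0 y) -> num_components e + 1 <= #|free_dirs u|.
Proof.
move=> bip le_k [y exy].
have x0F : x0 \in free_dirs u by rewrite inE eqxx.
rewrite (cardsD1 x0) x0F addnC leq_add2l.
suff sub : predI (roots e) 'I_n \subset [set comp i | i in free_dirs u :\ x0].
  exact: leq_trans (subset_leq_card sub) (leq_imset_card _ _).
apply/subsetP => r; rewrite inE andbT => /eqP rootr.
have ex_block : exists i, i \in block r.
  have [rx|rx] := eqVneq r x0; last by exists r; rewrite mem_block rootr eqxx.
  exists y; rewrite mem_block -(root_edge exy) -rx rootr eqxx rx /=.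
  apply/eqP => yx; case: bip => A /(_ _ _ exy).
  by rewrite yx eqxx.
have [i ri gi] := exists_raisable bip le_k ex_block.
have [j jF /andP[jx /eqP rj]] := raisable_free_dir gi.
by apply/imsetP; exists j; [rewrite in_setD1 jx | rewrite rj ri].
Qed.

Lemma weight_split u C :
  weight u C = (x0 \in C) * u x0 + \sum_r weight u (C :&: block r).
Proof.
rewrite weightE (bigD1 x0) //=; congr (_ + _).
under [RHS]eq_bigr do rewrite weightE.
rewrite exchange_big [RHS](bigD1 x0) //= [X in _ = X + _]big1 ?add0n => [|r _].
  apply: eq_bigr => i ix; rewrite (bigD1 (comp i)) //= !inE eqxx ix !andbT.
  rewrite big1 ?addn0 // => r ri.
  by rewrite !inE eq_sym (negPf ri) andbF.
by rewrite !inE eqxx !andbF.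
Qed.

(** On each block of [R] the cover [C] may be exchanged for a lightest one, since
    no edge joins two blocks. The edges at [x0] stay covered provided that [C]
    contains [x0], or that the block next to [x0] is left alone. *)
Lemma covers_weigh_replace u C (R : {set 'I_n}) :
    covers_weigh e k u -> vertex_cover e C -> (comp x0 \in R -> x0 \in C) ->
  k <= (x0 \in C) * u x0
       + \sum_r (if r \in R then block_weight r u else weight u (C :&: block r)).
Proof.
move=> /covers_weighP uP covC Rx0.
have [/existsP[r /andP[rR /eqP tk]]|/existsPn small] :=
  boolP [exists r, (r \in R) && (block_weight r u == k)].
  by rewrite (bigD1 r) //= rR tk; lia.
have /fin_all_exists[D DP] r : exists D, r \in R ->
    vertex_cover e D /\ weight u (D :&: block r) = block_weight r u.
  have [tk|[D covD wD]] := block_weight_attained r u; last by exists D.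
  by exists set0 => rR; have := small r; rewrite rR tk eqxx.
pose C' := [set i | if (comp i \in R) && (i != x0) then i \in D (comp i) else i \in C].
have /uP : vertex_cover e C'.
  apply/vertex_coverP => x y exy; rewrite !inE (root_edge exy).
  have := vertex_coverP _ _ covC _ _ exy.
  have [rR|//] := boolP (comp y \in R).
  have [covD _] := DP _ rR; have := vertex_coverP _ _ covD _ _ exy.
  have [xx|_] := eqVneq x x0; first by rewrite xx Rx0 // -xx (root_edge exy).
  have [yx|_] //= := eqVneq y x0.
  by rewrite yx Rx0 ?orbT // -yx.
move/leq_trans; apply; rewrite weight_split leq_add ?leq_mul //.
  by rewrite inE eqxx andbF.
apply: leq_sum => r _; case: ifP => rR.
  have [_ <-] := DP _ rR; rewrite !weightE; apply: leq_sum => i _.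
  rewrite !inE; case: (comp i =P r) => [->|_]; last by rewrite !andbF.
  by rewrite rR; case: (i != x0); rewrite ?andbF.
rewrite !weightE; apply: leq_sum => i _.
by rewrite !inE; case: (comp i =P r) => [->|_]; rewrite ?rR ?andbF.
Qed.

(** On the block, [v] lies between [u] and [u] raised at its only free vertex. *)
Lemma block_weight_free u v r : (forall i, v i <= k) ->
  (forall i, i \in block r -> u i <= v i) ->
  (forall i, i \notin free_dirs u -> v i = u i) ->
  block_weight r v = block_weight r u.
Proof.
move=> le_k le_uv off; apply/eqP; rewrite eqn_leq (block_weight_leq le_uv) andbT.
have [/existsP[d /andP[dF dr]]|/existsPn none] :=
  boolP [exists d, (d \in free_dirs u) && (d \in block r)]; last first.
  rewrite block_weight_leq // => i ir; rewrite off //.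
  by have := none i; rewrite ir andbT.
move: (dr); rewrite mem_block => /andP[/eqP rd dx].
move: (dF); rewrite mem_free_dirs // => /andP[/andP[_ /eqP]]; rewrite rd => <- _.
apply: block_weight_leq => i ir; rewrite /raise; case: eqP => // id.
rewrite off //; apply/negP => iF; apply: id.
move: ir; rewrite mem_block => /andP[/eqP ri ix].
by apply: (free_dirs_inj iF dF) => //; rewrite ri rd.
Qed.

(** Every raisable vertex of [v] is raisable in [u], because the block weights
    agree and raising is monotone; conversely the chosen vertices of [u] remain
    raisable, so they remain the least ones. *)
Lemma free_dirs_raise u v : (forall i, u i <= v i) -> (forall i, v i <= k) ->
  (forall i, i \notin free_dirs u -> v i = u i) -> free_dirs v = free_dirs u.
Proof.
move=> le_uv le_k off.
have eq_bw r : block_weight r v = block_weight r u by apply: block_weight_free.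
have shrink i : raisable v i -> raisable u i.
  move=> /andP[ix /eqP bv]; rewrite /raisable ix eqn_leq /=; apply/andP; split.
    rewrite -eq_bw -bv; apply: block_weight_leq => j _.
    by rewrite /raise; case: eqP.
  apply: block_weight_leq => j _; rewrite /raise; case: eqP => // _.
  exact: leq_trans (le_uv j) (le_k j).
have sub i : i \in free_dirs u -> i \in free_dirs v.
  have [->|ix] := eqVneq i x0; first by rewrite !inE eqxx.
  move=> iF; move: (iF); rewrite !mem_free_dirs // => /andP[gi /forallP mini].
  apply/andP; split; last first.
    apply/forallP => j; have := mini j; case: (_ && _) => //=.
    exact/contra/shrink.
  move: gi; rewrite /raisable ix /= eq_bw => /eqP <-; apply/eqP.
  apply: eq_block_weight => j; rewrite mem_block => /andP[/eqP rj jx].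
  rewrite /raise; case: eqP => // ji; apply: off; apply/negP => jF; apply: ji.
  exact: (free_dirs_inj jF iF).
apply/setP => i; apply/idP/idP => [iF|/sub//].
have [->|ix] := eqVneq i x0; first by rewrite !inE eqxx.
move: (iF); rewrite mem_free_dirs // => /andP[gi _].
have [j jF /andP[jx /eqP rj]] := raisable_free_dir (shrink i gi).
by rewrite -(free_dirs_inj (sub j jF) iF).
Qed.

Section Meet.

Variables u v : 'I_n -> nat.
Hypotheses (u_le : forall i, u i <= k) (v_le : forall i, v i <= k).
Hypothesis eqF : free_dirs u = free_dirs v.
Hypothesis off : forall i, i \notin free_dirs u -> u i = v i.

Let w i := minn (u i) (v i).

(** Inside a block, [u] and [v] differ in at most one coordinate, hence they are
    comparable there. *)
Lemma meet_block r :
  (forall i, i \in block r -> w i = u i) \/ (forall i, i \in block r -> w i = v i).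
Proof.
have [/existsP[d /andP[dr lt_vu]]|/existsPn le_uv] :=
  boolP [exists d, (d \in block r) && (v d < u d)]; last first.
  left=> i ir; apply/minn_idPl; have := le_uv i.
  by rewrite ir /= -leqNgt.
right=> i ir; apply/minn_idPr.
have [iF|/off-> //] := boolP (i \in free_dirs u).
have dF : d \in free_dirs u by apply: contraLR lt_vu => /off->; rewrite ltnn.
move: ir dr; rewrite !mem_block => /andP[/eqP ri ix] /andP[/eqP rd dx].
by rewrite (free_dirs_inj iF dF) // ?ri ?rd // ltnW.
Qed.

(** Inside a block, [u] and [v] differ in at most one coordinate, hence they are
    comparable there. *)
Lemma meet_block_weight r :
  block_weight r w = block_weight r u /\ block_weight r w = block_weight r v.
Proof.
have off' i : i \notin free_dirs v -> v i = u i by rewrite -eqF => /off.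
have [wu|wv] := meet_block r.
  have -> : block_weight r v = block_weight r u.
    by apply: block_weight_free => // [i /wu <-|i /off->//]; apply: geq_minr.
  by rewrite (eq_block_weight wu).
have -> : block_weight r u = block_weight r v.
  by apply: block_weight_free => // [i /wv <-|i /off'->//]; apply: geq_minl.
by rewrite (eq_block_weight wv).
Qed.

Lemma free_dirs_meet : free_dirs w = free_dirs u.
Proof.
apply/setP => i; have [wu|wv] := meet_block (comp i).
  exact: eq_free_dirs.
by rewrite eqF; apply: eq_free_dirs.
Qed.

(** For a cover containing [x0], compare with the point [z] among [u] and [v]
    whose coordinate at [x0] is smaller; for a cover omitting [x0], with the one
    that is smaller on the block next to [x0]. All other data are block weights,
    which [u], [v] and their meet share. *)
Lemma covers_weigh_meet :
  covers_weigh e k u -> covers_weigh e k v -> covers_weigh e k w.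
Proof.
move=> uP vP; apply/covers_weighP => C covC.
have bw r := meet_block_weight r.
have [x0C|x0C] := boolP (x0 \in C).
  suff [z [zP zx zb]] : exists z, [/\ covers_weigh e k z, w x0 = z x0
      & forall r, block_weight r w = block_weight r z].
    have := covers_weigh_replace (R := setT) zP covC (fun=> x0C).
    move/leq_trans; apply; rewrite weight_split zx leq_add2l.
    by apply: leq_sum => r _; rewrite inE -zb; apply: block_weight_le.
  have [le_uv|/ltnW le_vu] := leqP (u x0) (v x0).
    by exists u; split=> // [|r]; [apply/minn_idPl | case: (bw r)].
  by exists v; split=> // [|r]; [apply/minn_idPr | case: (bw r)].
(* the edges at [x0] forbid exchanging the cover on the block next to it *)
suff [z [zP zx zb]] : exists z, [/\ covers_weigh e k z,
      forall i, i \in block (comp x0) -> w i = z i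
    & forall r, block_weight r w = block_weight r z].
  have := covers_weigh_replace (R := ~: [set comp x0]) zP covC.
  rewrite !inE eqxx => /(_ (fun F => match notF F with end)).
  move/leq_trans; apply; rewrite weight_split (negPf x0C).
  apply: leq_sum => r _; rewrite !inE; case: eqP => /= [->|_].
    by rewrite leq_weight // => i /setIP[_ /zx->].
  by rewrite -zb; apply: block_weight_le.
have [wu|wv] := meet_block (comp x0).
  by exists u; split=> // r; case: (bw r).
by exists v; split=> // r; case: (bw r).
Qed.

End Meet.

End FreeDirections.

(** * Stanley decompositions from partitions of monomials *)

Section StanleyPartition.

Import GRing.Theory.

Variables (K : fieldType) (n : nat).
Local Notation S := {mpoly K[n]}.
Local Open Scope ring_scope.
Implicit Types (c m : 'X_{1..n}) (Z : {set 'I_n}) (f w : S).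

Definition in_space c Z m : bool :=
  [forall j, if j \in Z then (c j <= m j)%N else m j == c j].

Lemma stanley_span_monomial c Z w :
  stanley_span 'X_[c] Z w <-> {in msupp w, forall m, in_space c Z m}.
Proof.
split=> [[f fZ ->] m|wcZ].
  rewrite mulrC (perm_mem (msuppMX f c)) => /mapP[v vf ->].
  apply/forallP => j; rewrite mnmDE; case: ifP => [_|jZ]; first exact: leq_addr.
  have [->|vj] := eqVneq (v j) 0%N; first by rewrite addn0.
  by rewrite (fZ _ vf _ vj) in jZ.
exists (\sum_(m <- msupp w) w@_m *: 'X_[m - c]); last first.
  rewrite mulr_sumr [LHS]mpolyE; apply: eq_big_seq => m /wcZ /forallP mP.
  rewrite -scalerAr -mpolyXD addmC submK //; apply/mnm_lepP => j.
  by have := mP j; case: ifP => // _ /eqP->.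
move=> v vf j vj.
have [m mw] : exists2 m, m \in msupp w & v = (m - c)%MM.
  have := msupp_sum_le vf; rewrite filter_predT => /flattenP[_ /mapP[m mw ->]].
  by move=> /msuppZ_le /mem_msuppXP <-; exists m.
move=> vE; have /forallP/(_ j) := wcZ _ mw; case: ifP => // _ /eqP mj.
by move: vj; rewrite vE mnmBE mj subnn.
Qed.

Lemma sdepth_ge (M : S -> Prop) (D : stanley_decomposition M) d :
  (d <= n)%N -> (forall i, d <= #|@sd_vars _ _ _ D i|)%N -> lee (Fin d) (sdepth M).
Proof.
move=> le_dn le_d; rewrite /sdepth; case: asboolP => // _ /=.
have le_D : (d <= sdepth_decomposition D)%N.
  rewrite /sdepth_decomposition; elim/big_ind: _ => // a b da db.
  by rewrite leq_min da.
have lt_D : (sdepth_decomposition D < n.+1)%N.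
  rewrite /sdepth_decomposition; elim/big_rec: _ => // i t _ le_t.
  exact: leq_ltn_trans (geq_minr _ _) le_t.
apply: leq_trans le_D _; apply: (@leq_bigmax_cond _ _ _ (Ordinal lt_D)).
by apply/asboolP; exists D.
Qed.

(** Orthants of exponents that partition the monomials of [M] span the summands
    of a Stanley decomposition: the components of a polynomial are obtained by
    sorting its terms, and they are independent as their supports are disjoint. *)
Lemma sdepth_ge_of_partition (I : finType) (c : I -> 'X_{1..n}) (Z : I -> {set 'I_n})
    (Q : pred 'X_{1..n}) (M : S -> Prop) d :
    (forall f, M f <-> {in msupp f, forall m, Q m}) ->
    (forall m, Q m <-> exists i, in_space (c i) (Z i) m) ->
    (forall i j m, in_space (c i) (Z i) m -> in_space (c j) (Z j) m -> i = j) ->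
    (d <= n)%N -> (forall i, d <= #|Z i|)%N ->
  lee (Fin d) (sdepth M).
Proof.
move=> MQ QP disj le_dn le_dZ.
pose g (i : 'I_#|I|) : S := 'X_[c (enum_val i)]; pose V (i : 'I_#|I|) := Z (enum_val i).
have ghomog i : homogeneous (g i).
  by exists 1, (c (enum_val i)); rewrite scale1r.
have gfree i : stanley_free (g i) (V i).
  move=> f _ gf; apply/mpolyP => m; have := congr1 (mcoeff (c (enum_val i) + m)%MM) gf.
  by rewrite /g mulrC mcoeffMX !mcoeff0.
have gsum w : M w <-> exists2 s, forall i, stanley_span (g i) (V i) (s i) & w = \sum_i s i.
  split=> [/MQ wQ|[s sP ->]]; last first.
    apply/MQ => m; move/msupp_sum_le => /flattenP[_ /mapP[i _ ->]] mi.
    by apply/QP; exists (enum_val i); apply: (stanley_span_monomial _ _ _).1 (sP i) _ mi.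
  exists (fun i => \sum_(m <- msupp w | in_space (c (enum_val i)) (V i) m) w@_m *: 'X_[m]).
    move=> i; apply/stanley_span_monomial => m'.
    move/msupp_sum_le => /flattenP[_ /mapP[m + ->]].
    by rewrite mem_filter => /andP[mi _] /msuppZ_le /mem_msuppXP <-.
  rewrite (exchange_big_dep xpredT) //= [LHS]mpolyE; apply: eq_big_seq => m /wQ /QP[i im].
  rewrite (big_pred1 (enum_rank i)) // => j; apply/idP/eqP => [jm|->].
    by rewrite -(disj _ _ _ jm im) enum_valK.
  by rewrite /V enum_rankK.
have gdirect s : (forall i, stanley_span (g i) (V i) (s i)) ->
    \sum_i s i = 0 -> forall i, s i = 0.
  move=> sP s0 i; apply/mpolyP => m; rewrite mcoeff0; apply/eqP.
  rewrite mcoeff_eq0; apply/negP => mi.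
  have := congr1 (mcoeff m) s0; rewrite mcoeff0 raddf_sum (bigD1 i) //= big1 ?addr0.
    by apply/eqP; rewrite -mcoeff_msupp.
  move=> j ji; apply/eqP; rewrite mcoeff_eq0; apply: contra ji => mj.
  apply/eqP/enum_val_inj/(disj _ _ m).
    exact: (stanley_span_monomial _ _ _).1 (sP j) _ mj.
  exact: (stanley_span_monomial _ _ _).1 (sP i) _ mi.
apply: (sdepth_ge (D := StanleyDecomposition ghomog gfree gsum gdirect)) => // i.
exact: le_dZ.
Qed.

End StanleyPartition.

(** * Stanley spaces from free directions in a box *)

(** A set of points [P], determined by its trace on the box of points with
    coordinates at most [N], together with a set [F u] of free directions at
    each point. Points of [P] with the same free directions and the same other
    coordinates form a class, which is closed under meets, hence has a least
    element, and under upward moves along the free directions, hence is an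
    orthant of the box. Outside of the box, the coordinates equal to [N] become
    free too. *)
Section BoxPartition.

Variables (K : fieldType) (n N d : nat).
Variables (P : pred ('I_n -> nat)) (F : ('I_n -> nat) -> {set 'I_n}).
Implicit Types u v : 'I_n -> nat.

Hypothesis P_trunc : forall u, P (fun i => minn (u i) N) = P u.
Hypothesis P_mono : forall u v, (forall i, u i <= v i) -> P u -> P v.
Hypothesis F_raise : forall u v, (forall i, u i <= v i) -> (forall i, v i <= N) ->
  (forall i, i \notin F u -> v i = u i) -> F v = F u.
Hypothesis meet : forall u v, (forall i, u i <= N) -> (forall i, v i <= N) ->
  F u = F v -> (forall i, i \notin F u -> u i = v i) -> P u -> P v ->
  P (fun i => minn (u i) (v i)) /\ F (fun i => minn (u i) (v i)) = F u.

Local Notation box := {ffun 'I_n -> 'I_N.+1}.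
Implicit Types b : box.

Let pt b : 'I_n -> nat := fun i => b i.

Let trunc u : box := [ffun i => inord (minn (u i) N)].

Let pt_trunc u : pt (trunc u) = fun i => minn (u i) N.
Proof. by apply: funext => i; rewrite /pt ffunE inordK // ltnS geq_minr. Qed.

Let pt_le b i : pt b i <= N.
Proof. exact: leq_ord. Qed.

Let same b b' := [&& P (pt b), P (pt b'), F (pt b) == F (pt b')
  & [forall i, (i \notin F (pt b)) ==> (b i == b' i)]].

Let sameP b b' : reflect [/\ P (pt b), P (pt b'), F (pt b) = F (pt b')
  & forall i, i \notin F (pt b) -> pt b i = pt b' i] (same b b').
Proof.
apply: (iffP and4P) => [[Pb Pb' /eqP FE /forallP off]|[Pb Pb' FE off]]; split=> //.
- by move=> i iF; have := off i; rewrite iF => /eqP/(congr1 val).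
- exact/eqP.
by apply/forallP => i; apply/implyP => /off bi; apply/eqP/val_inj.
Qed.

Let least b := P (pt b) && [forall b', same b b' ==> [forall i, b i <= b' i]].

Let base := {b | least b}.

Let vars (x : base) := F (pt (val x)) :|: [set i | pt (val x) i == N].

Let same_sym b b' : same b b' -> same b' b.
Proof.
move=> /sameP[Pb Pb' FE off]; apply/sameP; split=> // i.
by rewrite -FE => /off->.
Qed.

Let same_trans b1 b2 b3 : same b1 b2 -> same b2 b3 -> same b1 b3.
Proof.
move=> /sameP[P1 P2 F12 off12] /sameP[_ P3 F23 off23]; apply/sameP; split=> //.
  by rewrite F12.
by move=> i iF; rewrite off12 // off23 // -F12.
Qed.

Let exists_least b : P (pt b) -> exists x : base, same (val x) b.
Proof.
move=> Pb; have bb : same b b by apply/sameP.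
case: (arg_minnP (fun b' : box => \sum_i b' i) bb) => a ab min_a.
suff la : least a by exists (Sub a la); rewrite SubK; apply: same_sym.
have /sameP[_ Pa _ _] := ab.
rewrite /least Pa; apply/forallP => b'; apply/implyP => ab'.
have /sameP[_ Pb' FE off] := ab'.
pose w := trunc (fun i => minn (pt a i) (pt b' i)).
have wE : pt w = fun i => minn (pt a i) (pt b' i).
  rewrite pt_trunc; apply: funext => i; apply/minn_idPl.
  by rewrite geq_min pt_le.
(* the meet with the point of least coordinate sum cannot be smaller *)
have [Pw Fw] := meet (pt_le a) (pt_le b') FE off Pa Pb'.
rewrite -wE in Pw Fw.
have aw : same a w.
  apply/sameP; split=> // i iF; rewrite wE -off //; exact/esym/minnn.
have le_wa i : pt w i <= pt a i by rewrite wE geq_minl.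
apply/forallP => i.
change (pt a i <= pt b' i); suff <- : pt w i = pt a i by rewrite wE geq_minr.
apply/eqP; rewrite eqn_leq le_wa leqNgt; apply/negP => lt_wa.
have := min_a w (same_trans ab aw); rewrite leqNgt => /negP; apply.
rewrite (bigD1 i) //= [X in _ < X](bigD1 i) //= -addSn leq_add //.
by apply: leq_sum => j _; apply: le_wa.
Qed.

Let corner (x : base) : 'X_{1..n} := [multinom pt (val x) i | i < n].

Let in_spaceE (x : base) (m : 'X_{1..n}) :
  in_space (corner x) (vars x) m = same (val x) (trunc m).
Proof.
have /andP[Px /forallP le_x] := valP x.
(* a coordinate that is free only because it equals [N] is constant in the box *)
apply/forallP/idP => [mP|sx j].
  have mP' j : pt (val x) j <= m j /\ (j \notin vars x -> m j = pt (val x) j).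
    by have := mP j; rewrite mnmE; case: ifP => [//|_ /eqP->].
  have le_t i : pt (val x) i <= pt (trunc m) i.
    by rewrite pt_trunc leq_min pt_le andbT; case: (mP' i).
  apply/sameP; split=> //.
  - exact: P_mono Px.
  - apply/esym/F_raise => // i iF.
    rewrite pt_trunc; have [le_m off] := mP' i.
    have [xN|xN] := eqVneq (pt (val x) i) N; first by rewrite -[in LHS]xN (minn_idPr le_m).
    by rewrite off ?inE ?negb_or ?iF //; apply/minn_idPl.
  - move=> i iF; rewrite pt_trunc; have [le_m off] := mP' i.
    have [xN|xN] := eqVneq (pt (val x) i) N; first by rewrite -[in RHS]xN (minn_idPr le_m).
    by rewrite off ?inE ?negb_or ?iF //; apply/esym/minn_idPl.
have /forallP le_m := implyP (le_x (trunc m)) sx.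
have le_mj : pt (val x) j <= m j.
  apply: leq_trans (le_m j) _; have := congr1 (@^~ j) (pt_trunc m).
  by rewrite /pt => ->; apply: geq_minl.
rewrite mnmE; case: ifP => // /negbT; rewrite !inE negb_or => /andP[jF jN].
have /sameP[_ _ _ off] := sx; have := off j jF; rewrite pt_trunc => E.
by apply/eqP; rewrite E; move: jN; rewrite E; case: leqP => //; rewrite eqxx.
Qed.

Lemma sdepth_ge_of_free_directions (M : {mpoly K[n]} -> Prop) :
    (forall f, M f <-> {in msupp f, forall m : 'X_{1..n}, P m}) ->
    (forall u, (forall i, u i <= N) -> d <= #|F u|) ->
  lee (Fin d) (sdepth M).
Proof.
move=> MP cardF.
apply: (sdepth_ge_of_partition (c := corner) (Z := vars)) MP _ _ _ _.
- move=> m; split=> [Pm|[x]].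
    have [|x sx] := @exists_least (trunc m); first by rewrite pt_trunc P_trunc.
    by exists x; rewrite in_spaceE.
  by rewrite in_spaceE => /sameP[_ + _ _]; rewrite pt_trunc P_trunc.
- move=> x y m; rewrite !in_spaceE => sx sy.
  have sxy := same_trans sx (same_sym sy).
  have /andP[_ /forallP/(_ (val y))] := valP x; rewrite sxy => /forallP le_xy.
  have /andP[_ /forallP/(_ (val x))] := valP y; rewrite (same_sym sxy) => /forallP le_yx.
  by apply/val_inj/ffunP => i; apply/val_inj/eqP; rewrite eqn_leq le_xy; apply: le_yx.
- apply: leq_trans (cardF (fun=> 0) _) _ => //.
  by rewrite -[X in _ <= X]card_ord max_card.
move=> x; apply: leq_trans (cardF _ (pt_le (val x))) _.
exact/subset_leq_card/subsetUl.
Qed.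

End BoxPartition.

(** * Powers of the edge ideal of a bipartite graph *)

Section EdgeIdealPowers.

Import GRing.Theory.

Variables (K : fieldType) (n : nat) (e : rel 'I_n).
Local Open Scope ring_scope.
Implicit Types (f a b : {mpoly K[n]}) (m : 'X_{1..n}).

Lemma ideal_gen_mem (R : comNzRingType) (A : R -> Prop) (a : R) :
  A a -> ideal_gen A a.
Proof.
move=> Aa; exists [:: (1, a)]; split; last by rewrite big_seq1 mul1r.
by move=> t; rewrite inE => /eqP->.
Qed.

Lemma ideal_gen_covers_weigh k (A : {mpoly K[n]} -> Prop) :
    (forall a, A a -> {in msupp a, forall m, covers_weigh e k m}) ->
  forall f, ideal_gen A f -> {in msupp f, forall m, covers_weigh e k m}.
Proof.
move=> AQ _ [s [sA ->]] m /msupp_sum_le; rewrite filter_predT.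
move=> /flattenP[_ /mapP[t ts ->]] /msuppM_le /allpairsP[[m1 m2] /= [_ m2t ->]].
apply: covers_weigh_leq (AQ _ (sA t ts) _ m2t) => i.
by rewrite mnmDE leq_addl.
Qed.

(** Every monomial of a product of [k] edges, and of its multiples, meets each
    cover at least [k] times. Conversely the edges of such a product are removed
    from a monomial one at a time. *)
Lemma ideal_exp_edge_idealP k f :
    ssrbool.symmetric e -> bipartite e ->
  ideal_exp (edge_ideal K e) k f <-> {in msupp f, forall m, covers_weigh e k m}.
Proof.
move=> sym_e bip; elim: k f => [|k IHk] f.
  by split=> // _ m _; apply/covers_weighP.
split=> [|fQ].
  apply: ideal_gen_covers_weigh => _ [a [b [Ia /IHk bQ ->]]] m.
  move=> /msuppM_le /allpairsP[[m1 m2] /= [m1a m2b ->]].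
  have {Ia}aQ : covers_weigh e 1 m1.
    move: m1a; apply: (ideal_gen_covers_weigh _ Ia) => _ [i [j [eij ->]]] {}m1.
    rewrite -mpolyXD => /mem_msuppXP <-; apply/covers_weighP => C covC.
    have [l lC le_l] : exists2 l, l \in C & (0 < (U_(i) + U_(j))%MM l)%N.
      case/orP: (vertex_coverP _ _ covC _ _ eij) => lC; [exists i | exists j] => //.
        by rewrite mnmDE !mnm1E eqxx.
      by rewrite mnmDE !mnm1E eqxx addn1.
    by rewrite /weight (bigD1 l) //= (leq_trans le_l) // leq_addr.
  apply/covers_weighP => C covC.
  have -> : weight (m1 + m2)%MM C = (weight m1 C + weight m2 C)%N.
    by rewrite /weight -big_split; apply: eq_bigr => i _; rewrite mnmDE.
  by rewrite -add1n leq_add ?(covers_weighP _ _ _ aQ) ?(covers_weighP _ _ _ (bQ _ m2b)).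
exists [seq ((f@_m)%:MP, 'X_[m]) | m <- msupp f]; split; last first.
  by rewrite big_map [LHS]mpolyE; apply: eq_bigr => m _; rewrite mul_mpolyC.
move=> _ /mapP[m mf ->] /=.
have [x [y [exy mx my mQ]]] := covers_weigh_remove_edge sym_e bip (fQ m mf).
exists ('X_x * 'X_y), 'X_[m - U_(x) - U_(y)]; split.
- by apply: ideal_gen_mem; exists x, y.
- apply/IHk => _ /mem_msuppXP <-; apply: covers_weigh_leq mQ => i.
  by rewrite !mnmBE !mnm1E ![i == _]eq_sym.
(* subtraction of exponents is truncated: it is exact here since [x != y] *)
rewrite -!mpolyXD; congr 'X_[_]; apply/mnmP => i.
have xy : x != y by case: bip => A /(_ _ _ exy); apply: contraNneq => ->.
rewrite !mnmDE !mnmBE !mnm1E.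
have [xi|] := eqVneq x i; have [yi|] := eqVneq y i; last by lia.
- by rewrite xi yi eqxx in xy.
- by move: mx; rewrite xi; lia.
by move: my; rewrite yi; lia.
Qed.

End EdgeIdealPowers.

Theorem corollary3p5 (K : fieldType) (n : nat) (e : rel 'I_n)
    (simple_e : simple_graph e) (bipartite_e : bipartite e)
    (edge_e : exists i j : 'I_n, e i j) (k : nat) (k_gt0 : (0 < k)%N)
    (k_le : le_half_plus1 k (max_component_girth e)) :
  lee (Fin (num_components e + 1)) (sdepth (ideal_exp (edge_ideal K e) k)).
Proof.
have [sym_e _] := simple_e; have [x0 [y exy]] := edge_e.
apply: (@sdepth_ge_of_free_directions K n k _ (covers_weigh e k) (free_dirs e x0 k)).
- by move=> u; apply: covers_weigh_trunc.
- by move=> u v; apply: covers_weigh_leq.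
- by move=> u v; apply: free_dirs_raise.
- move=> u v u_le v_le eqF off uP vP; split; first exact: covers_weigh_meet eqF off uP vP.
  exact: free_dirs_meet.
- by move=> f; apply: ideal_exp_edge_idealP.
by move=> u u_le; apply: card_free_dirs => //; exists y.
Qed.
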